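(* Let $\mathcal{G}=(\mathcal{N},\mathcal{E})$ be a communication network of agents (directed and possibly disconnected), let $\mathcal{V}_i$ ($i\in\mathcal{N}$) be the agents' finite action sets, let $\mathcal{V}=\bigcup_{i\in\mathcal{N}}\mathcal{V}_i$, and let $f:2^{\mathcal{V}}\to\mathbb{R}$ be normalized, non-decreasing submodular, and 2nd-order submodular. Then each agent $i\in\mathcal{N}$ performs $O(|\mathcal{V}_i|\,|\mathcal{N}_i^-|)$ function evaluations during the algorithm RAG described in the context.
   Context: Notation. The network $\mathcal{G}=(\mathcal{N},\mathcal{E})$ is fixed during the execution of the algorithm. $\mathcal{N}_i^-=\{j\in\mathcal{N}:(j,i)\in\mathcal{E}\}$ is the set of in-neighbors of $i$ and $\mathcal{N}_i^+=\{j\in\mathcal{N}:(i,j)\in\mathcal{E}\}$ the set of out-neighbors. $|\cdot|$ denotes cardinality. For $s\in\mathcal{V}$ and $\mathcal{A}\subseteq\mathcal{V}$, the marginal gain is $f(s\,|\,\mathcal{A})=f(\mathcal{A}\cup\{s\})-f(\mathcal{A})$. Function classes. $f:2^{\mathcal{V}}\to\mathbb{R}$ is normalized and non-decreasing submodular if $f(\emptyset)=0$; $f(\mathcal{A})\le f(\mathcal{B})$ whenever $\mathcal{A}\subseteq\mathcal{B}\subseteq\mathcal{V}$; and $f(s\,|\,\mathcal{A})\ge f(s\,|\,\mathcal{B})$ whenever $\mathcal{A}\subseteq\mathcal{B}\subseteq\mathcal{V}$ and $s\in\mathcal{V}$. It is 2nd-order submodular if $f(s\,|\,\mathcal{C})-f(s\,|\,\mathcal{A}\cup\mathcal{C})\ge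 f(s\,|\,\mathcal{B}\cup\mathcal{C})-f(s\,|\,\mathcal{A}\cup\mathcal{B}\cup\mathcal{C})$ for all (pairwise) disjoint $\mathcal{A},\mathcal{B},\mathcal{C}\subseteq\mathcal{V}$ and all $s\in\mathcal{V}$. Algorithm RAG (Resource-Aware distributed Greedy), run by every agent with synchronous communication. Agent $i$ keeps a set $\mathcal{I}_i$ (the agents in $\mathcal{N}_i^-$ that have selected an action) and a set $\mathcal{S}_i$ (the actions selected by the agents in $\mathcal{I}_i$), both initially empty. While agent $i$ has not selected an action $s_i^{\mathrm{RAG}}$, it repeats the following iteration: (1) $s_i\leftarrow\arg\max_{y\in\mathcal{V}_i}[f(\mathcal{S}_i\cup\{y\})-f(\mathcal{S}_i)]$ and $g_i\leftarrow f(\mathcal{S}_i\cup\{s_i\})-f(\mathcal{S}_i)$; (2) transmit $g_i$ to each agent in $\mathcal{N}_i^+\setminus\mathcal{I}_i$ and receive $g_j$ from each $j\in\mathcal{N}_i^-\setminus\mathcal{I}_i$; (3) if $i=\arg\max_{j\in(\mathcal{N}_i^-\cup\{i\})\setminus\mathcal{I}_i} g_j$, select $s_i^{\mathrm{RAG}}\leftarrow s_i$ and transmit $s_i$ to each agent in $\mathcal{N}_i^+\setminus\mathcal{I}_i$; (4) otherwise, let $\mathcal{I}_i^{\mathrm{new}}$ be the (possibly empty) set of agents $j\in\mathcal{N}_i^-\setminus\mathcal{I}_i$ that selected an action in this iteration, receive $s_j^{\mathrm{RAG}}$ from each $j\in\mathcal{I}_i^{\mathrm{new}}$, and set $\mathcal{I}_i\leftarrow\mathcal{I}_i\cup\mathcal{I}_i^{\mathrm{new}}$,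 $\mathcal{S}_i\leftarrow\mathcal{S}_i\cup\{s_j^{\mathrm{RAG}}\}_{j\in\mathcal{I}_i^{\mathrm{new}}}$. Agent $i$ returns $s_i^{\mathrm{RAG}}$. No rule for breaking ties in the argmax operations is specified. Counting of evaluations. Agent $i$ re-evaluates the marginal gains of all $v\in\mathcal{V}_i$ every time an in-neighbor $j\in\mathcal{N}_i^-$ selects an action; the count is taken to be $|\mathcal{N}_i^-|\,|\mathcal{V}_i|$ evaluations in the worst case and $|\mathcal{V}_i|$ in the best case.
   Formalization: The factor |N_i^-| in the bound is replaced by max(1, |N_i^-|), because an agent with no in-neighbors still performs |V_i| evaluations once, so the literal bound would be 0 and false; for agents with in-neighbors the bound is unchanged. *)

(* Defs.v *)
From mathcomp Require Import all_boot all_order all_algebra.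
From mathcomp Require Import reals.
Set Implicit Arguments.
Unset Strict Implicit.
Unset Printing Implicit Defensive.
Import Order.TTheory GRing.Theory Num.Theory.
Local Open Scope ring_scope.

Section SetFunctions.
Variables (R : realType) (T : finType).
Implicit Types (f : {set T} -> R) (A B C : {set T}) (s : T).

Definition marginal f s A : R := f (A :|: [set s]) - f A.

Definition nondecreasing_submodular f : Prop :=
  [/\ f set0 = 0,
      forall A B, A \subset B -> f A <= f B
    & forall A B s, A \subset B -> marginal f s B <= marginal f s A].

Definition second_order_submodular f : Prop :=
  forall A B C s,
    [disjoint A & B] -> [disjoint A & C] -> [disjoint B & C] ->
    marginal f s (B :|: C) - marginal f s (A :|: B :|: C)
      <= marginal f s C - marginal f s (A :|: C).

End SetFunctions.

(* Ties are left open: any maximizer qualifies. *)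
Definition is_argmax (R : realType) (X : finType) (D : {set X}) (h : X -> R)
    (x : X) : Prop :=
  x \in D /\ forall y, y \in D -> h y <= h x.

Section RAG.
Variables (R : realType) (N T : finType).
Variables (E : {set N * N}) (V : N -> {set T}) (f : {set T} -> R).

Definition in_nbrs (i : N) : {set N} := [set j | (j, i) \in E].

(* Joint state of all the agents at the start of an iteration:
   [chosen i] is [Some s] once agent i has selected s, [known i] is the set
   I_i of agents and [gathered i] the set S_i of actions. *)
Record config := Config {
  chosen : N -> option T;
  known : N -> {set N};
  gathered : N -> {set T} }.

Definition active (c : config) (i : N) : bool := chosen c i == None.

(* The set I_i^new of the iteration leading from c to c'. *)
Definition newly (c c' : config) (i : N) : {set N} :=
  [set j in in_nbrs i :\: known c i | active c j && ~~ active c' j].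

(* One synchronous iteration. [s i] is the candidate action of agent i and
   [l i] the element that agent i takes as argmax of the gains it compares, so
   that i selects iff l i = i; both tie-breakings are arbitrary, and may differ
   between agents and between iterations. For j not active, [s j], and hence
   [g j], is arbitrary; it is never read, because an agent that is still active
   has all its already selected in-neighbors in its set [known]. For the same
   reason a transmission to N_j^+ \ I_j reaches every active out-neighbor of j,
   so that messages need not be represented. *)
Definition rag_iteration (c c' : config) : Prop :=
  exists (s : N -> T) (l : N -> N),
    let g j := marginal f (s j) (gathered c j) in
    forall i : N,
      if active c i then
        [/\ is_argmax (V i) (fun y => marginal f y (gathered c i)) (s i),
            is_argmax ((in_nbrs i :|: [set i]) :\: known c i) g (l i)
          & if l i == i then
              [/\ chosen c' i = Some (s i),
                  known c' i = known c i
                & gathered c' i = gathered c i]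
            else
              [/\ chosen c' i = None,
                  known c' i = known c i :|: newly c c' i
                & gathered c' i
                  = gathered c i :|: [set s j | j in newly c c' i]]]
      else
        [/\ chosen c' i = chosen c i,
            known c' i = known c i
          & gathered c' i = gathered c i].

(* [sigma t] is the state after t iterations; it stays constant once every
   agent has selected. Termination is not assumed, since some tie-breakings
   let agents wait for each other forever. *)
Definition rag_execution (sigma : nat -> config) : Prop :=
  (forall i, [/\ chosen (sigma 0%N) i = None,
                 known (sigma 0%N) i = set0
               & gathered (sigma 0%N) i = set0])
  /\ forall t, rag_iteration (sigma t) (sigma t.+1).

(* Agent i, as long as it has not selected, computes its marginal gains in its
   first iteration, and again in each iteration that follows one in which some
   of its in-neighbors selected an action. In the other iterations S_i has not
   changed and the gains already computed are reused. *)
Definition evaluates (sigma : nat -> config) (i : N) (t : nat) : bool :=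
  active (sigma t) i &&
  (if t is t'.+1 then newly (sigma t') (sigma t) i != set0 else true).

(* Function evaluations made by agent i in the first n iterations, one for
   the marginal gain of each action in V_i. *)
Definition evaluations (sigma : nat -> config) (i : N) (n : nat) : nat :=
  (\sum_(t < n | evaluates sigma i t) #|V i|)%N.

End RAG.

(* Main.v *)
(* Agent i evaluates once at the start; each further evaluation follows an
   iteration that added at least one new in-neighbor to I_i. Since I_i only
   grows and stays inside N_i^-, there are at most 1 + |N_i^-| rounds of
   |V_i| evaluations. *)
Require Import Defs.
From mathcomp Require Import all_boot all_order all_algebra.
From mathcomp Require Import reals.

Section Execution.
Variables (R : realType) (N T : finType) (E : {set N * N}).
Variables (V : N -> {set T}) (f : {set T} -> R).

(** An agent that selects now or has selected before is inactive in [c'] and keeps its set, so the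
    three branches of an iteration merge into one test on [c']. *)
Lemma known_rag_iteration (c c' : config N T) (i : N) :
  rag_iteration E V f c c' ->
  known c' i = known c i :|: (if active c' i then newly E c c' i else set0).
Proof.
case=> s [l /(_ i)]; rewrite /active.
case: eqP => [_ [_ _] | /eqP/negbTE ci [-> -> _]]; last by rewrite ci setU0.
by case: ifP => _ [-> -> _] /=; rewrite ?eqxx ?setU0.
Qed.

Lemma newly_sub_in_nbrs (c c' : config N T) (i : N) :
  newly E c c' i \subset in_nbrs E i :\: known c i.
Proof. by apply/subsetP=> j; rewrite !inE => /andP[->]. Qed.

Variable sigma : nat -> config N T.
Hypothesis sigmaP : rag_execution E V f sigma.

Lemma known_sub_in_nbrs (t : nat) (i : N) :
  known (sigma t) i \subset in_nbrs E i.
Proof.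
have [init step] := sigmaP.
elim: t => [|t IHt]; first by have [_ -> _] := init i; apply: sub0set.
rewrite (known_rag_iteration _ _ i (step t)) subUset IHt /=.
case: ifP => _; last exact: sub0set.
exact: subset_trans (newly_sub_in_nbrs _ _ _) (subsetDl _ _).
Qed.

Lemma card_known_step (t : nat) (i : N) :
  #|known (sigma t) i| + evaluates E sigma i t.+1 <= #|known (sigma t.+1) i|.
Proof.
rewrite (known_rag_iteration _ _ i (sigmaP.2 t)) /evaluates.
case: (active _ _) => /=; last by rewrite addn0 setU0.
have /subset_trans/(_ (subsetDr _ _)) := newly_sub_in_nbrs (sigma t) (sigma t.+1) i.
(* Disjointness is the equality case of [leq_card_setU], so the cardinal of the union becomes a
   sum. *)
rewrite -disjoints_subset disjoint_sym -leq_card_setU => /eqP->.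
by rewrite leq_add2l -card_gt0; case: #|_|.
Qed.

(** The 1 pays for iteration 0; an evaluation in iteration [t.+1] is charged to the growth of
    [known] from [sigma t] to [sigma t.+1], hence [n.+1] iterations against [sigma n]. *)
Lemma evaluating_iterations_le (i : N) (n : nat) :
  \sum_(t < n.+1) evaluates E sigma i t <= 1 + #|known (sigma n) i|.
Proof.
elim: n => [|n IHn].
  by rewrite big_ord1; apply: leq_trans (leq_b1 _) (leq_addr _ _).
rewrite big_ord_recr /=; apply: leq_trans (leq_add IHn (leqnn _)) _.
by rewrite -addnA leq_add2l card_known_step.
Qed.

Lemma evaluations_le (i : N) (n : nat) :
  evaluations E V sigma i n <= (1 + #|in_nbrs E i|) * #|V i|.
Proof.
rewrite /evaluations; case: n => [|n]; first by rewrite big_ord0.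
rewrite big_mkcond /=.
under eq_bigr => t _ do rewrite -mulnbl.
rewrite -big_distrl /= leq_mul2r; apply/orP; right.
apply: leq_trans (evaluating_iterations_le i n) _.
by rewrite leq_add2l subset_leq_card // known_sub_in_nbrs.
Qed.

End Execution.

(** [K] is chosen before all data, so it is uniform. The [maxn 1] covers an agent without
    in-neighbors, which still evaluates once. *)
Theorem proposition1 :
  exists K : nat,
  forall (R : realType) (N T : finType) (E : {set N * N}) (V : N -> {set T})
         (f : {set T} -> R),
    \bigcup_(i : N) V i = [set: T] ->
    nondecreasing_submodular f ->
    second_order_submodular f ->
    forall sigma : nat -> config N T,
      rag_execution E V f sigma ->
      forall (i : N) (n : nat),
        (evaluations E V sigma i n <= K * (#|V i| * maxn 1 #|in_nbrs E i|))%N.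
Proof.
(* Both summands of [1 + #|in_nbrs E i|] are at most [maxn 1 #|in_nbrs E i|], whence the factor
   2. *)
exists 2 => R N T E V f _ _ _ sigma sigmaP i n.
apply: leq_trans (evaluations_le _ _ _ _ _ _ _ sigmaP i n) _.
rewrite [#|V i| * _]mulnC mulnA leq_mul2r mul2n -addnn.
by rewrite leq_add ?orbT // ?leq_maxl ?leq_maxr.
Qed.
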